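(* Let $T(N)$ denote the number of nodes of the lattice $\Lambda_N$. There is a constant $c_1$ such that for all $N$, $$\ln\ln T(N)\;\le\;c_1\,\frac{\ln N}{\ln\ln N}\,(1+o(1)),$$ where $o(1)$ is as $N\to\infty$.
   Context: An orthogonal array $OA(N, s_1^{k_1} s_2^{k_2}\cdots s_v^{k_v})$ (of strength 2) is an $N\times k$ array, $k=k_1+\cdots+k_v$, whose first $k_1$ columns have entries from $\{0,\dots,s_1-1\}$, next $k_2$ columns entries from $\{0,\dots,s_2-1\}$, etc., such that in every $N\times 2$ subarray every possible ordered pair of symbols occurs equally often as a row. Normally $2\le s_1<s_2<\cdots$ and all $k_i\ge1$; one also allows the trivial array $OA(N,1^1)$, a single column of $N$ zeros. The symbol $(N,s_1^{k_1}s_2^{k_2}\cdots)$ is a parameter set; it is realized if such an array exists. Expansive replacement: given an $OA$ $A$ with $N$ runs and a column of $A$ with $S$ levels, and an orthogonal array $B$ with $S$ runs (possibly the trivial $OA(S,1^1)$), replace that column by the rows of $B$ (symbol $j$ replaced by the $j$-th row of $B$); this includes deleting a factor and replacing an $s$-level factor by an $s'$-level factor when $s'\mid s$. A parameter set $P$ is dominated by $Q$ if an array with parameter set $P$ can be obtained from one with parameter set $Q$ by a finite sequence of expansive replacements. $\Lambda_N$ is the set of realized parameter sets with $N$ runs, partially ordered by dominance (a lattice with maximum $(N,N^1)$ and minimum $(N,1^1)$). *)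

(* Defs.v *)
From HB Require Import structures.
From mathcomp Require Export all_boot all_order all_algebra.
From mathcomp Require Export finmap.
From mathcomp Require Export all_classical all_reals all_analysis.

Set Implicit Arguments.
Unset Strict Implicit.
Unset Printing Implicit Defensive.

Export Order.TTheory GRing.Theory Num.Theory.
Export numFieldNormedType.Exports.

(* The symbol (N, s_1^k_1 ... s_v^k_v) with the run size N left out:
   the sequence of the pairs (s_i, k_i). *)
Definition param_set := seq (nat * nat).

Definition is_param_set (p : param_set) : bool :=
  (p == [:: (1, 1)]) ||
  [&& p != [::], sorted ltn (unzip1 p)
    & all (fun x => (2 <= x.1) && (1 <= x.2)) p].

(* The numbers of levels of the k_1 + ... + k_v columns, from left to right. *)
Definition levels (p : param_set) : seq nat :=
  flatten [seq nseq x.2 x.1 | x <- p].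

(* The condition on single columns follows from the one on pairs when there are
   at least two columns; for a one-column array it is the usual convention,
   without which (N, s^1) would be realized for all s and (N, N^1) would not be
   the maximum. *)
Definition is_OA (N : nat) (lv : seq nat) (A : 'M[nat]_(N, size lv)) : Prop :=
  [/\ forall i j, A i j < nth 0 lv j,
      forall (j : 'I_(size lv)) a a', a < nth 0 lv j -> a' < nth 0 lv j ->
        #|[set i | A i j == a]| = #|[set i | A i j == a']|
    & forall j1 j2 : 'I_(size lv), j1 != j2 -> forall a b a' b',
        a < nth 0 lv j1 -> b < nth 0 lv j2 ->
        a' < nth 0 lv j1 -> b' < nth 0 lv j2 ->
        #|[set i | (A i j1 == a) && (A i j2 == b)]|
        = #|[set i | (A i j1 == a') && (A i j2 == b')]|].

Definition realized (N : nat) (p : param_set) : Prop :=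
  exists A : 'M[nat]_(N, size (levels p)), is_OA A.

(* The dominance order is not needed to count the nodes. *)
Definition Lambda (N : nat) : set param_set :=
  [set p | is_param_set p /\ realized N p]%classic.

(* [fset_set] is meaningful on finite sets only: see [finite_Lambda]. *)
Definition num_nodes (N : nat) : nat := #|` fset_set (Lambda N)|.

Lemma OA_level_le N lv (A : 'M[nat]_(N, size lv)) (j : 'I_(size lv)) :
  0 < N -> is_OA A -> nth 0 lv j <= N.
Proof.
move=> N0 [Alt Abal _].
have inA a : a < nth 0 lv j -> exists i, A i j = a.
  move=> ha; pose i0 := Ordinal N0.
  have := Abal j a (A i0 j) ha (Alt i0 j).
  have : 0 < #|[set i | A i j == A i0 j]|.
    by apply/card_gt0P; exists i0; rewrite inE.
  move=> + e; rewrite -e => /card_gt0P[i]; rewrite inE => /eqP <-.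
  by exists i.
have inA' (a : 'I_(nth 0 lv j)) : exists i, A i j == a.
  by have [i <-] := inA a (ltn_ord a); exists i.
pose f (a : 'I_(nth 0 lv j)) := xchoose (inA' a).
have fI : injective f.
  have fE a : A (f a) j = a by apply/eqP/(xchooseP (inA' a)).
  by move=> a b fab; apply/val_inj; rewrite /= -fE fab fE.
by have := leq_card f fI; rewrite !card_ord.
Qed.

Lemma OA_ncols_le N lv (A : 'M[nat]_(N, size lv)) :
  0 < N -> all (leq 2) lv -> is_OA A -> size lv <= N ^ N.
Proof.
move=> N0 lv2 oaA; have [Alt Abal Apair] := oaA.
have AN i j : A i j < N by apply: leq_trans (Alt i j) (OA_level_le j N0 oaA).
pose f (j : 'I_(size lv)) := [ffun i : 'I_N => Ordinal (AN i j)].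
have fI : injective f.
  move=> j1 j2 /ffunP fj; apply/eqP/negPn/negP => j12.
  have e i : A i j1 = A i j2.
    by have /(congr1 val) := fj i; rewrite !ffunE.
  have l2 (j : 'I_(size lv)) : 2 <= nth 0 lv j.
    by apply: (allP lv2); rewrite mem_nth.
  pose i0 := Ordinal N0; pose b := if A i0 j1 == 0 then 1 else 0.
  have bne : A i0 j1 != b by rewrite /b; case: (A i0 j1).
  have blt : b < nth 0 lv j2.
    by apply: leq_trans (l2 j2); rewrite /b; case: ifP.
  have a2 : A i0 j1 < nth 0 lv j2 by rewrite e.
  have := Apair _ _ j12 _ _ _ _ (Alt i0 j1) a2 (Alt i0 j1) blt.
  have : 0 < #|[set i | (A i j1 == A i0 j1) && (A i j2 == A i0 j1)]|.
    by apply/card_gt0P; exists i0; rewrite inE -e eqxx.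
  move=> + h; rewrite h => /card_gt0P[i]; rewrite inE -e => /andP[/eqP -> /eqP].
  by move/eqP; rewrite (negbTE bne).
by have := leq_card f fI; rewrite card_ffun !card_ord.
Qed.

Lemma finite_Lambda N : 0 < N -> finite_set (Lambda N).
Proof.
move=> N0.
pose n := N.+1; pose m := (N ^ N).+1.
pose g (s : n.-bseq ('I_n * 'I_m)%type) : param_set :=
  [seq (val x.1, val x.2) | x <- s].
have -> : Lambda N = (Lambda N `&` (g @` setT))%classic.
  apply/esym/setIidPl => p [pP [A oaA]].
  have [->|/andP[_ /andP[srt al]]] := predU1P pP.
    have h1 : 1 < n by rewrite ltnS.
    have h2 : 1 < m by rewrite ltnS expn_gt0 N0.
    have hs : size [:: (Ordinal h1, Ordinal h2)] <= n by [].
    by exists (Bseq hs).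
  have lv2 : all (leq 2) (levels p).
    apply/allP => s /flattenP[t /mapP[x xp ->]] /nseqP[-> _].
    by have /andP[] := allP al _ xp.
  have szp x : x \in p -> x.1 < n /\ x.2 < m.
    move=> xp; have /andP[x1 x2] := allP al _ xp; split.
      have : x.1 \in levels p.
        apply/flattenP; exists (nseq x.2 x.1); first by apply/mapP; exists x.
        by apply/nseqP.
      move=> xl; rewrite ltnS -(nth_index 0 xl).
      have ix : index x.1 (levels p) < size (levels p) by rewrite index_mem.
      exact: (OA_level_le (Ordinal ix) N0 oaA).
    rewrite ltnS; apply: leq_trans (OA_ncols_le N0 lv2 oaA).
    rewrite /levels size_flatten /shape -map_comp.
    have -> : x.2 = (size \o (fun x : nat * nat => nseq x.2 x.1)) x.
      by rewrite /= size_nseq.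
    rewrite sumnE big_map (big_rem x xp) /=; exact: leq_addr.
  have sz : size p <= n.
    have u1 : uniq (unzip1 p) := sorted_uniq ltn_trans ltnn srt.
    rewrite -(size_map fst) -(size_iota 0 n); apply: uniq_leq_size => // s.
    by move=> /mapP[x xp ->]; rewrite mem_iota add0n; have [] := szp _ xp.
  pose q := [seq ((inord x.1 : 'I_n), (inord x.2 : 'I_m)) | x <- p].
  have sq : size q <= n by rewrite size_map.
  exists (Bseq sq) => //; rewrite /g /= /q -map_comp -[RHS]map_id.
  by apply/eq_in_map => -[a b] /szp[/= h1 h2]; rewrite !inordK.
exact/finite_setIr/finite_image/finite_finset.
Qed.

(* Hence ln (ln T(N)) is meaningful for N >= 2. *)
Lemma num_nodes_gt1 N : 1 < N -> 1 < num_nodes N.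
Proof.
move=> N1; have N0 : 0 < N by apply: leq_trans N1.
have r1 : Lambda N [:: (1, 1)].
  split => //; exists (\matrix_(i, j) 0)%R; split.
  - by move=> i j; rewrite mxE; case: j => -[].
  - by move=> -[[]//= ?] [|?] [|?].
  - by move=> [[]//= ?] [[]//= ?]; rewrite -val_eqE.
have rN : Lambda N [:: (N, 1)].
  split; first by rewrite /is_param_set /= N1 orbT.
  exists (\matrix_(i, j) val i)%R; split.
  - by move=> i [[]//= ?]; rewrite mxE.
  - move=> [[]//= ?] a a' ha ha'.
    have c1 b (hb : b < N) (M : 'M[nat]_(N, 1)) jj :
        (forall i, M i jj = i) -> #|[set i | M i jj == b]| = 1.
      move=> ME; apply/eqP/cards1P; exists (Ordinal hb); apply/setP => i.
      by rewrite !inE ME -val_eqE.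
    by rewrite !c1 // => i; rewrite mxE.
  - by move=> [[]//= ?] [[]//= ?]; rewrite -val_eqE.
have sub : ([fset [:: (1, 1)]; [:: (N, 1)]] `<=` fset_set (Lambda N))%fset.
  apply/fsubsetP => p; rewrite !inE in_fset_set; last exact: finite_Lambda.
  by move=> /orP[] /eqP ->; apply/mem_set.
apply: leq_trans (fsubset_leq_card sub).
by rewrite cardfs2 eqseq_cons xpair_eqE eqxx !andbT eq_sym; case: eqP N1 => [->|].
Qed.

(* Main.v *)
(* The contrasts s_j 1_(A i j = 0) - 1 attached to the columns of an orthogonal
   array with N runs are orthogonal nonzero vectors, so there are at most N
   columns, and every number of levels divides N. A node is therefore determined
   by a map from the divisors of N to {0, ..., N}, and T(N) <= (N + 1) ^ d(N).
   The claim follows from Wigert's bound ln d(N) = O(ln N / ln ln N). *)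

Require Import Defs.
From mathcomp Require Import all_boot all_order all_algebra.
From mathcomp Require Import all_classical all_reals all_analysis.
From mathcomp Require Import ring lra zify.

Set Implicit Arguments.
Unset Strict Implicit.
Unset Printing Implicit Defensive.

(** * Row counts: levels divide the run size *)

Lemma card_uniform_fibers (T U : finType) (f : T -> U) n :
  (forall u, #|[set x | f x == u]| = n) -> #|T| = #|U| * n.
Proof.
move=> fn; rewrite -sum1_card (partition_big f predT) //=.
rewrite (eq_bigr (fun=> n)) ?sum_nat_const // => u _.
by rewrite sum1_card -[RHS](fn u); apply: eq_card => x; rewrite !inE.
Qed.

(** The symbols of column [j] split the rows into classes of equal size; the class of 0 represents
    them all. In particular the number of levels divides [N]. *)
Lemma OA_column_count N lv (A : 'M[nat]_(N, size lv)) (j : 'I_(size lv)) :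
  is_OA A -> 0 < nth 0 lv j -> N = nth 0 lv j * #|[set i | A i j == 0]|.
Proof.
move=> [Alt Abal _] s0; rewrite -[LHS]card_ord -[X in X * _]card_ord.
apply: (card_uniform_fibers (f := fun i => Ordinal (Alt i j))) => u.
rewrite (Abal j 0 u s0 (ltn_ord u)).
by apply: eq_card => i; rewrite !inE -val_eqE.
Qed.

Lemma OA_pair_count N lv (A : 'M[nat]_(N, size lv)) (j k : 'I_(size lv)) :
  is_OA A -> j != k -> 0 < nth 0 lv j -> 0 < nth 0 lv k ->
  N = nth 0 lv j * nth 0 lv k * #|[set i | (A i j == 0) && (A i k == 0)]|.
Proof.
move=> [Alt _ Apair] jk sj sk.
rewrite -[LHS]card_ord -[X in X * _ * _]card_ord -[X in _ * X * _]card_ord.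
rewrite -card_prod.
pose f i := (Ordinal (Alt i j), Ordinal (Alt i k)).
apply: (card_uniform_fibers (f := f)) => -[u v].
rewrite (Apair j k jk 0 0 u v sj sk (ltn_ord u) (ltn_ord v)).
by apply: eq_card => i; rewrite !inE xpair_eqE -!val_eqE.
Qed.

Lemma card_set_sumr (R : pzRingType) (T : finType) (P : pred T) :
  (#|[set x | P x]|%:R = \sum_x (P x)%:R :> R)%R.
Proof.
rewrite -sum1_card natr_sum [LHS](big_mkcond _) /=.
by apply: eq_bigr => x _; rewrite inE; case: (P x).
Qed.

(** * Orthogonal contrasts and the number of columns *)

Section Contrast.
Local Open Scope ring_scope.

(** This is the inner product of two contrasts, expanded so that only row counts remain. *)
Lemma sum_contrast (R : comPzRingType) (T : finType) (P Q : pred T) (s t : R) :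
  \sum_x (s * (P x)%:R - 1) * (t * (Q x)%:R - 1) =
  s * t * #|[set x | P x && Q x]|%:R - s * #|[set x | P x]|%:R
  - t * #|[set x | Q x]|%:R + #|T|%:R.
Proof.
rewrite !card_set_sumr -cardsT -[#|[set: T]|]/(#|[set x : T | predT x]|).
rewrite card_set_sumr !mulr_sumr -!sumrB -big_split /=.
by apply: eq_bigr => x _; case: (P x); case: (Q x) => /=; ring.
Qed.

(** The rows of [V] are the contrasts. Their Gram matrix is diagonal with entries [N * (s_j - 1)],
    nonzero since [s_j >= 2], so [V] has rank [size lv], which cannot exceed its [N] columns. *)
Lemma OA_ncols_le_runs N lv (A : 'M[nat]_(N, size lv)) :
  (0 < N)%N -> all (leq 2) lv -> is_OA A -> (size lv <= N)%N.
Proof.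
move=> N0 lv2 oaA.
have s2 (j : 'I_(size lv)) : (1 < nth 0%N lv j)%N.
  by apply: (allP lv2); rewrite mem_nth.
have s0 (j : 'I_(size lv)) : (0 < nth 0%N lv j)%N := ltnW (s2 j).
pose V : 'M[rat]_(size lv, N) :=
  \matrix_(j, i) ((nth 0%N lv j)%:R * (A i j == 0%N)%:R - 1).
pose d : 'rV[rat]_(size lv) := \row_j (N%:R * ((nth 0%N lv j)%:R - 1)).
have VV : V *m V^T = diag_mx d.
  apply/matrixP => j k; rewrite !mxE.
  rewrite (eq_bigr (fun i => ((nth 0%N lv j)%:R * (A i j == 0%N)%:R - 1) *
     ((nth 0%N lv k)%:R * (A i k == 0%N)%:R - 1))); last first.
    by move=> i _; rewrite !mxE.
  rewrite (sum_contrast (fun i => A i j == 0%N) (fun i => A i k == 0%N)).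
  rewrite card_ord -!natrM -!(OA_column_count oaA (s0 _)).
  (* The row counts give [s N - N - N + N] on the diagonal and [N - N - N + N = 0] off it. *)
  have [->|jk] := eqVneq j k.
    under eq_finset do rewrite andbb.
    by rewrite -mulnA -(OA_column_count oaA (s0 _)) mulr1n natrM; ring.
  by rewrite -(OA_pair_count oaA jk (s0 _) (s0 _)) mulr0n; ring.
have : \rank (V *m V^T) = size lv.
  apply: mxrank_unit; rewrite VV unitmxE det_diag unitfE.
  apply/prodf_neq0 => j _; rewrite mxE mulf_neq0 ?pnatr_eq0 -?lt0n //.
  by rewrite subr_eq0 pnatr_eq1 gtn_eqF.
by move=> <-; apply: leq_trans (mxrankM_maxl _ _) (rank_leq_col _).
Qed.

End Contrast.

(** * Nodes encoded as maps on the divisors of N *)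

Lemma mem_levels p x : x \in p -> 0 < x.2 -> x.1 \in levels p.
Proof.
move=> xp x0; apply/flattenP; exists (nseq x.2 x.1).
  exact: map_f.
by rewrite mem_nseq x0 eqxx.
Qed.

Lemma param_leq_size_levels p x : x \in p -> x.2 <= size (levels p).
Proof.
move=> xp; rewrite /levels size_flatten /shape -map_comp sumnE big_map.
by rewrite (big_rem x xp) /= size_nseq leq_addr.
Qed.

Lemma param_set_sorted p : is_param_set p -> sorted ltn (unzip1 p).
Proof. by move=> /predU1P[->//|/and3P[]]. Qed.

Lemma param_set_pos p x : is_param_set p -> x \in p -> (0 < x.1) && (0 < x.2).
Proof.
move=> /predU1P[->|/and3P[_ _ /allP ap]]; first by rewrite inE => /eqP ->.
by move=> /ap /andP[/ltnW -> ->].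
Qed.

Lemma Lambda_bounds N p x : 0 < N -> Lambda N p -> x \in p ->
  (x.1 %| N) && (x.2 <= N).
Proof.
move=> N0 [pP [A oaA]] xp; apply/andP; split.
  have /andP[x1 x2] := param_set_pos pP xp.
  have xl := mem_levels xp x2.
  have ix : index x.1 (levels p) < size (levels p) by rewrite index_mem.
  have := OA_column_count (j := Ordinal ix) oaA.
  rewrite /= nth_index // => /(_ x1) NE.
  by apply/dvdnP; exists #|[set i | A i (Ordinal ix) == 0]|; rewrite mulnC.
(* The trivial set [1^1] is treated apart, because the contrast bound requires at least two
   levels. *)
have [pE|/and3P[_ _ ap]] := predU1P pP.
  by move: xp; rewrite pE inE => /eqP ->.
apply: leq_trans (param_leq_size_levels xp) _.
apply: OA_ncols_le_runs oaA => //.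
apply/allP => s /flattenP[t /mapP[y yp ->]] /nseqP[-> _].
by have /andP[] := allP ap _ yp.
Qed.

Lemma num_nodes_le N : 0 < N -> num_nodes N <= N.+1 ^ size (divisors N).
Proof.
move=> N0; set D := divisors N.
(* Multiplicity 0 encodes an absent number of levels, hence the filter. *)
pose g (f : {ffun 'I_(size D) -> 'I_N.+1}) : param_set :=
  [seq x <- [seq (nth 0 D i, val (f i))
              | i : 'I_(size D) <- enum 'I_(size D)] | 0 < x.2].
have sub : (fset_set (Lambda N) `<=`
    [fset g f | f in {ffun 'I_(size D) -> 'I_N.+1}])%fset.
  apply/fsubsetP => p; rewrite in_fset_set; last exact: finite_Lambda.
  move=> /set_mem pL; have [pP _] := pL.
  have up := sorted_uniq ltn_trans ltnn (param_set_sorted pP).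
  have bd x : x \in p -> (x.1 \in D) && (x.2 < N.+1).
    move=> xp; have /andP[x1 x2] := Lambda_bounds N0 pL xp.
    by rewrite -dvdn_divisors // x1 ltnS.
  (* If [s] does not occur in [p], the index is out of range and the default pair gives
     [k s = 0]. *)
  pose k s := (nth (0, 0) p (index s (unzip1 p))).2.
  have kE x : x \in p -> k x.1 = x.2.
    move=> xp; rewrite /k; set i := index _ _.
    have ip : i < size p by rewrite -(size_map fst) index_mem map_f.
    suff -> : i = index x p by rewrite nth_index.
    apply/eqP; rewrite -(nth_uniq 0 _ _ up) ?size_map ?index_mem //.
    by rewrite nth_index ?map_f // (nth_map (0, 0)) ?index_mem // nth_index.
  have kP s : 0 < k s -> (s, k s) \in p.
    rewrite /k; have [sp|sp] := boolP (s \in unzip1 p).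
      move=> _; have /mapP[x xp ->] := sp.
      by rewrite -/(k x.1) kE // -surjective_pairing.
    rewrite nth_default //.
    by move: sp; rewrite -index_mem -leqNgt size_map.
  pose f := [ffun i : 'I_(size D) => inord (k (nth 0 D i)) : 'I_N.+1].
  apply/imfsetP; exists f => //=.
  have fE (i : 'I_(size D)) : val (f i) = k (nth 0 D i).
    rewrite ffunE /= inordK // ltnS.
    case: (posnP (k (nth 0 D i))) => [-> //|/kP/bd /andP[_]]; exact.
  (* Both sequences increase strictly in the first component, so they are equal once they have the
     same members. *)
  pose r : rel (nat * nat) := [rel x y | x.1 < y.1].
  have rT : transitive r by move=> y x z; apply: ltn_trans.
  apply: (irr_sorted_eq rT); first by move=> x; apply: ltnn.
  - by move: (param_set_sorted pP); rewrite sorted_map.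
  - apply: sorted_filter => //; rewrite sorted_map.
    have := sorted_divisors_ltn N.
    by rewrite -/D -{1}(mkseq_nth 0 D) /mkseq -val_enum_ord !sorted_map.
  move=> x; rewrite mem_filter; apply/idP/andP.
    move=> xp; have /andP[_ x2] := param_set_pos pP xp; split=> //.
    have /andP[xD _] := bd x xp.
    have iD : index x.1 D < size D by rewrite index_mem.
    apply/mapP; exists (Ordinal iD); first by rewrite mem_enum.
    by rewrite fE /= nth_index // kE // -surjective_pairing.
  move=> [x2 /mapP[i _ xE]]; move: x2; rewrite xE /= fE; exact: kP.
apply: leq_trans (fsubset_leq_card sub) _.
apply: leq_trans (leq_imfset_card _ _ _) _.
rewrite /= -cardE /=.
by rewrite card_ffun !card_ord.
Qed.

(** * Bounds for the number of divisors *)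

(** A divisor [d] of [m * n] is the product of [gcdn d m], which divides [m], and [d %/ gcdn d m],
    which divides [n]. *)
Lemma size_divisorsM m n : 0 < m -> 0 < n ->
  size (divisors (m * n)) <= size (divisors m) * size (divisors n).
Proof.
move=> m0 n0; rewrite -(size_allpairs muln).
apply: uniq_leq_size; first exact: divisors_uniq.
move=> d; rewrite -dvdn_divisors ?muln_gt0 ?m0 // => dmn.
apply/allpairsP; exists (gcdn d m, d %/ gcdn d m) => /=.
have g0 : 0 < gcdn d m by rewrite gcdn_gt0 m0 orbT.
split; last by rewrite mulnC divnK // dvdn_gcdl.
  by rewrite -dvdn_divisors // dvdn_gcdr.
rewrite -dvdn_divisors // -(dvdn_pmul2l g0) mulnC divnK ?dvdn_gcdl //.
by rewrite muln_gcdl dvdn_gcd dvdn_mulr.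
Qed.

Lemma size_divisors_pfactor p k : prime p -> size (divisors (p ^ k)) <= k.+1.
Proof.
move=> pp; rewrite -[leqRHS](size_iota 0) -[leqRHS](size_map (expn p)).
apply: uniq_leq_size; first exact: divisors_uniq.
move=> d; rewrite -dvdn_divisors ?expn_gt0 ?prime_gt0 //.
move=> /(dvdn_pfactor _ _ pp)[m mk ->]; apply: map_f.
by rewrite mem_iota add0n ltnS mk.
Qed.

Lemma size_divisors_le_prod N : 0 < N ->
  size (divisors N) <= \prod_(0 <= p < N.+1) (logn p N).+1.
Proof.
move=> N0; rewrite -[X in divisors X](partnT N0) /partn.
(* Positivity is carried through the induction because submultiplicativity needs it. *)
suff [] : 0 < \prod_(0 <= p < N.+1) p ^ logn p N /\
  size (divisors (\prod_(0 <= p < N.+1) p ^ logn p N))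
    <= \prod_(0 <= p < N.+1) (logn p N).+1 by [].
apply: (big_ind2 (fun x y => 0 < x /\ size (divisors x) <= y)) => //.
  move=> x1 x2 y1 y2 [x10 h1] [y10 h2]; rewrite muln_gt0 x10 y10; split=> //.
  exact: leq_trans (size_divisorsM _ _) (leq_mul _ _).
move=> p _; have [pp|pp] := boolP (prime p).
  by rewrite expn_gt0 prime_gt0 //; split=> //; apply: size_divisors_pfactor.
by rewrite lognE (negbTE pp).
Qed.

(* Primes below [y] contribute at most [1 + log2 N] each; the others satisfy
   [logn p N + 1 <= 2 ^ logn p N], and [w] is their total multiplicity. *)
Lemma size_divisors_le N y : 0 < N -> 0 < y -> exists2 w,
  y ^ w <= N & size (divisors N) <= (trunc_log 2 N).+1 ^ y * 2 ^ w.
Proof.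
move=> N0 y0; exists (\sum_(0 <= p < N.+1 | y <= p) logn p N).
  rewrite expn_sum.
  apply: (@leq_trans (\prod_(0 <= p < N.+1 | y <= p) p ^ logn p N)).
    by apply: leq_prod => p yp; case: (logn p N) => // k; rewrite leq_exp2r.
  rewrite -[leqRHS](partnT N0) /partn.
  rewrite [leqRHS](bigID (fun p => y <= p)) /= leq_pmulr //.
  (* The index [p = 0] contributes [0 ^ 0 = 1]. *)
  apply: prodn_cond_gt0 => p _; rewrite expn_gt0.
  by case: p => //; rewrite logn0.
apply: leq_trans (size_divisors_le_prod N0) _.
rewrite (bigID (fun p => p < y)) /=; apply: leq_mul.
  apply: (@leq_trans (\prod_(0 <= p < N.+1 | p < y) (trunc_log 2 N).+1)).
    (* For a prime [p], [2 ^ logn p N <= p ^ logn p N <= N]. *)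
    apply: leq_prod => p _; rewrite ltnS trunc_log_max //.
    have [pp|pp] := boolP (prime p); last by rewrite lognE (negbTE pp) expn0.
    apply: leq_trans (dvdn_leq N0 (pfactor_dvdnn p N)).
    by case: (logn p N) => // k; rewrite leq_exp2r ?prime_gt1.
  rewrite big_const_seq iter_muln muln1 leq_pexp2l //.
  rewrite -size_filter -[leqRHS](size_iota 0).
  apply: uniq_leq_size; first by rewrite filter_uniq ?iota_uniq.
  by move=> p; rewrite mem_filter mem_iota => /andP[].
rewrite expn_sum.
under eq_bigl do rewrite -leqNgt.
by apply: leq_prod => p _; apply: ltn_expl.
Qed.

(** * Real estimates and Wigert's bound *)

Section Analysis.
Local Open Scope ring_scope.
Variable R : realType.
Implicit Types x : R.

(** The inequality [1 + x <= expR x] at [1/2] gives [e >= 9/4]; at [-1/6] it gives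
    [1/e >= (5/6)^6 > 1/3]. *)
Lemma expR1_bounds : 2 < expR (1 : R) < 3.
Proof.
apply/andP; split.
  have h : 1 + 2^-1 <= expR (2^-1 : R) := expR_ge1Dx _.
  have -> : 1 = 2%:R * (2^-1) :> R by rewrite divff.
  by rewrite expRM_natl expr2; nra.
have h : 1 + (- 6^-1) <= expR (- 6^-1 : R) := expR_ge1Dx _.
have e : expR (- 1 : R) = expR (- 6^-1) ^+ 6.
  by rewrite -expRM_natl mulrN divff.
have h6 : (5 / 6 : R) ^+ 6 <= expR (- 1).
  rewrite e lerXn2r ?nnegrE ?expR_ge0 //; lra.
have k : expR 1 * expR (- 1) = 1 :> R by rewrite -expRD subrr expR0.
have : 0 < expR (1 : R) := expR_gt0 _.
by move: h6 k; rewrite !exprS expr0; nra.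
Qed.

Lemma ln_nat_gt0 (n : nat) : (1 < n)%N -> 0 < ln (n%:R : R).
Proof. by move=> n1; rewrite ln_gt0 // ltr1n. Qed.

(** Otherwise [n = e], an integer strictly between 2 and 3. *)
Lemma lnln_nat_neq0 (n : nat) : (1 < n)%N -> ln (ln (n%:R : R)) != 0.
Proof.
move=> n1; rewrite ln_eq0 ?ln_nat_gt0 //; apply/eqP => e.
have : (n%:R : R) = expR 1 by rewrite -[LHS]lnK ?e // posrE ltr0n ltnW.
have := expR1_bounds => /[swap] <-.
by rewrite !ltr_nat ltnS => /andP[/leq_trans h /h]; rewrite ltnn.
Qed.

Lemma ln2_bounds : 2^-1 <= ln (2 : R) <= 1.
Proof.
have /andP[e2 e3] := expR1_bounds.
apply/andP; split; last first.
  by rewrite -[leRHS](expRK (1 : R)) ler_ln ?posrE ?expR_gt0 // ltW.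
rewrite -(expRK (2^-1 : R)) ler_ln ?posrE ?expR_gt0 //.
have : expR (2^-1 : R) ^+ 2 < 4.
  by rewrite -expRM_natl divff //; lra.
have := expR_gt0 (2^-1 : R); rewrite expr2; nra.
Qed.

(** With [u] the fourth root of [x], [ln x = 4 ln u <= 4 u]; then square. *)
Lemma sqr_ln_le x : 1 <= x -> ln x ^+ 2 <= 16 * Num.sqrt x.
Proof.
move=> x1; set t := Num.sqrt x; set u := Num.sqrt t.
have x0 : 0 < x by lra.
have t0 : 0 < t by rewrite sqrtr_gt0.
have u0 : 0 < u by rewrite sqrtr_gt0.
have tE : t = u ^+ 2 by rewrite sqr_sqrtr // ltW.
have xE : x = u ^+ 4 by rewrite (exprM _ 2 2) -tE sqr_sqrtr // ltW.
have l0 : 0 <= ln x by rewrite ln_ge0.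
have lu : ln x <= 4 * u.
  by rewrite xE lnXn // -[leLHS]mulr_natl ler_pM2l // ltW // ln_sublinear.
by rewrite tE; nra.
Qed.

Lemma ln_natX (m n : nat) : (0 < m)%N -> ln ((m ^ n)%:R : R) = n%:R * ln m%:R.
Proof. by move=> m0; rewrite natrX lnXn ?ltr0n // mulr_natl. Qed.

Lemma ler_ln_nat (m n : nat) : (0 < m)%N -> (m <= n)%N ->
  ln (m%:R : R) <= ln n%:R.
Proof.
by move=> m0 mn; rewrite ler_ln ?posrE ?ltr0n ?ler_nat // (leq_trans m0).
Qed.

(* Wigert's bound, from the splitting of the primes at [y ~ sqrt (ln N)]. *)
Lemma ln_size_divisors_le (N : nat) : (0 < N)%N -> 9 <= ln (N%:R : R) ->
  ln ((size (divisors N))%:R : R) <= 66 * (ln N%:R / ln (ln N%:R)).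
Proof.
move=> N0; set x := ln (N%:R : R) => x9; set L := ln x.
have L0 : 0 < L by rewrite ln_gt0 //; lra.
set t := Num.sqrt x.
have t1 : 1 <= t by rewrite -sqrtr1 ler_sqrt; lra.
have tt : t ^+ 2 = x by rewrite sqr_sqrtr; lra.
have L2 : L ^+ 2 <= 16 * t by apply: sqr_ln_le; lra.
pose y := (Num.truncn t).+1.
have ty : t < y%:R := truncnS_gt t.
have y2 : y%:R <= 2 * t.
  have : (Num.truncn t)%:R <= t by rewrite truncn_le; lra.
  by rewrite -[y]addn1 natrD; lra.
have [w yw Dw] := size_divisors_le N0 (ltn0Sn (Num.truncn t)).
rewrite -/y in yw Dw; set l := trunc_log 2 N in Dw.
have /andP[ln2 ln2'] := ln2_bounds.
(* From [y ^ w <= N] and [ln y >= ln t = L / 2]. *)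
have hw : w%:R <= 2 * (x / L).
  have : w%:R * ln (y%:R : R) <= x.
    by rewrite -ln_natX //; apply: ler_ln_nat; rewrite ?expn_gt0.
  have Ly : L / 2 <= ln (y%:R : R).
    have LE : L = ln t + ln t by rewrite /L -tt lnXn ?mulr2n //; lra.
    have : ln t <= ln (y%:R : R) by rewrite ler_ln ?posrE ?ltr0n //; lra.
    by lra.
  have w0 : 0 <= w%:R :> R by [].
  by rewrite mulrA ler_pdivlMr //; nra.
(* Since [ln 2 >= 1/2], [l <= 2 x], and so [l + 1 <= x ^ 2]. *)
have hl : ln (l.+1%:R : R) <= 2 * L.
  have lN : l%:R * ln (2 : R) <= x.
    rewrite -ln_natX //; apply: ler_ln_nat; rewrite ?expn_gt0 //.
    by have /andP[] := @trunc_log_bounds 2 N isT N0.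
  have l0 : 0 <= l%:R :> R by [].
  have l1 : l.+1%:R <= x ^+ 2 by rewrite -[l.+1]addn1 natrD; nra.
  rewrite mulr_natl -lnXn; last by lra.
  by rewrite ler_ln ?posrE ?ltr0n //; rewrite exprn_gt0 //; lra.
have hD : ln ((size (divisors N))%:R : R) <= y%:R * ln l.+1%:R + w%:R * ln 2.
  rewrite -!ln_natX // -lnM ?posrE ?ltr0n ?expn_gt0 // -natrM.
  apply: ler_ln_nat => //.
  by rewrite lt0n size_eq0; apply: contraTneq (divisors_id N0) => ->.
(* The product is at most [4 t L], and [L ^ 2 <= 16 t] turns this into [64 t ^ 2 / L]. Adding
   [w ln 2 <= 2 x / L] gives 66. *)
have hy : y%:R * ln (l.+1%:R : R) <= 64 * (x / L).
  have l0 : 0 <= ln (l.+1%:R : R) by rewrite ln_ge0 // ler1n.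
  apply: (@le_trans _ _ ((2 * t) * (2 * L))); first by apply: ler_pM.
  by rewrite mulrA ler_pdivlMr // -tt; nra.
have w0 : 0 <= w%:R :> R by [].
by nra.
Qed.

Lemma lnln_num_nodes_le (N : nat) : (1 < N)%N -> 9 <= ln (N%:R : R) ->
  ln (ln ((num_nodes N)%:R : R)) <= 98 * (ln N%:R / ln (ln N%:R)).
Proof.
move=> N1 x9; have N0 : (0 < N)%N := ltnW N1.
have := ln_size_divisors_le N0 x9; move: x9.
set x := ln (N%:R : R) => x9; set L := ln x; set d := size (divisors N) => hD.
have d0 : 0 < d%:R :> R.
  by rewrite ltr0n lt0n size_eq0; apply: contraTneq (divisors_id N0) => ->.
have L0 : 0 < L by rewrite ln_gt0 //; lra.
(* Here [N + 1 <= N ^ 2] gives [ln (N + 1) <= 2 x]. *)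
have hT : ln ((num_nodes N)%:R : R) <= d%:R * (2 * x).
  apply: (@le_trans _ _ (ln (N.+1 ^ d)%:R)).
    by apply: ler_ln_nat (num_nodes_le N0); apply: ltnW; apply: num_nodes_gt1.
  rewrite ln_natX // ler_pM2l // -(ln_natX 2) //.
  by apply: ler_ln_nat => //; nia.
have T0 := ln_nat_gt0 (num_nodes_gt1 N1).
have : ln (ln ((num_nodes N)%:R : R)) <= ln d%:R + (ln 2 + L).
  have x2 : 0 < 2 * x by lra.
  rewrite -(lnM (x := 2)) ?posrE //; last by lra.
  by rewrite -lnM ?posrE // ler_ln ?posrE // mulr_gt0.
have /andP[_ ln2] := ln2_bounds.
have L1 : 1 <= L.
  have /andP[_ e3] := expR1_bounds.
  by rewrite -(expRK (1 : R)) ler_ln ?posrE ?expR_gt0 //; lra.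
(* As [ln 2 <= 1 <= L], this term covers [ln 2 + L]; the constant is [98 = 66 + 32]. *)
have : 2 * L <= 32 * (x / L).
  have h : L ^+ 2 <= 16 * Num.sqrt x by apply: sqr_ln_le; lra.
  have tx : Num.sqrt x ^+ 2 = x by rewrite sqr_sqrtr; lra.
  have t1 : 1 <= Num.sqrt x by rewrite -sqrtr1 ler_sqrt; lra.
  by rewrite mulrA ler_pdivlMr //; nra.
by lra.
Qed.

End Analysis.

(** * The asymptotic statement *)

Local Open Scope classical_set_scope.
Local Open Scope ring_scope.

Theorem theorem3 (R : realType) :
  exists (c1 : R) (eps : nat -> R),
    (eps n @[n --> \oo] --> (0 : R)) /\
    forall N : nat, (1 < N)%N ->
      ln (ln ((num_nodes N)%:R : R)) <=
        c1 * (ln (N%:R : R) / ln (ln (N%:R : R))) * (1 + eps N).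
Proof.
pose rhs N : R := 98 * (ln N%:R / ln (ln N%:R)).
(* [eps] absorbs the small [N], where [rhs] may be negative; this needs
   [ln (ln N) != 0], i.e. that [expR 1] is not an integer. *)
exists 98, (fun N => if 9 <= ln (N%:R : R) then 0
                     else ln (ln (num_nodes N)%:R) / rhs N - 1); split.
  (* As soon as [n > expR 9], the error term is exactly 0. *)
  apply: cvg_near_cst; exists (Num.truncn (expR (9 : R))).+1 => // n /= hn.
  rewrite ifT // -(expRK (9 : R)).
  have h : expR 9 < n%:R :> R.
    by apply: lt_le_trans (truncnS_gt _) _; rewrite ler_nat.
  by rewrite ler_ln ?posrE ?expR_gt0 ?ltW // (lt_trans _ h) ?expR_gt0.
move=> N N1; case: ifP => [x9|_].
  by rewrite addr0 mulr1; apply: lnln_num_nodes_le.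
(* For small [N] the two sides are equal by the choice of the error term, [rhs N] being nonzero. *)
rewrite -/(rhs N) addrC subrK mulrC divfK //.
rewrite mulf_neq0 // mulf_neq0 ?invr_eq0 ?lnln_nat_neq0 //.
by rewrite gt_eqF ?ln_nat_gt0.
Qed.
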